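(* Let $\Omega$ be a subgraph of a host graph with $\partial\Omega\neq\emptyset$, let $T>0$, let $f:\Omega\times[0,T]\times\mathbb{R}\to\mathbb{R}$, $g\in C^0(\partial\Omega\times[0,T])$ and $\psi:\Omega\to\mathbb{R}$ be given, and let $\mathcal{B}u=u$ or $\mathcal{B}u=\frac{\partial u}{\partial_\Omega n}$. Consider the problem $$u_t-\Delta_\Omega u=f(x,t,u)\ \text{ on }\Omega\times(0,T],\qquad \mathcal{B}u=g\ \text{ on }\partial\Omega\times(0,T],\qquad u(x,0)=\psi(x)\ \text{ on }\Omega. \quad (P)$$ Let $\overline{u}$ and $\underline{u}$ be an upper and a lower solution of (P), respectively, and set $\overline{\Omega}_T=\overline{\Omega}\times[0,T]$, $\underline{\eta}=\min_{\overline{\Omega}_T}\min\{\overline{u},\underline{u}\}$ and $\overline{\eta}=\max_{\overline{\Omega}_T}\max\{\overline{u},\underline{u}\}$. Suppose that for every $x\in\Omega$ the function $f(x,t,z)$ is continuous with respect to $(t,z)\in[0,T]\times[\underline{\eta},\overline{\eta}]$, and that there is a constant $M>0$ with $$|f(x,t,u)-f(x,t,v)|\le M|u-v|\quad\text{for all }(x,t)\in\Omega\times(0,T],\ u,v\in[\underline{\eta},\overline{\eta}].$$ Then (P) admits a unique solution $u\in C^0(\overline{\Omega}_T)\cap C^1(\Omega\times[0,T])$ satisfying $\underline{u}\le u\le\overline{u}$ on $\overline{\Omega}_T$.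
   Context: The host graph $G=(V,E)$ is finite, undirected and connected, with weight $\omega:V\times V\to[0,\infty)$, $\omega_{xy}=\omega_{yx}$, $\omega_{xy}=0$ iff $xy\notin E$, and measure $\mu:V\to(0,\infty)$. $\Omega$ is a connected, simple, induced subgraph (identified with its vertex set); $\partial\Omega=\{z\in V\setminus\Omega: z\sim y\text{ for some }y\in\Omega\}$ and $\overline{\Omega}=\Omega\cup\partial\Omega$. For $x\in\Omega$, $\Delta_\Omega u(x)=\sum_{y\in\overline{\Omega}}(u(y)-u(x))\frac{\omega_{yx}}{\mu(x)}$ (acting in $x$). For $z\in\partial\Omega$, $\frac{\partial u}{\partial_\Omega n}(z)=\sum_{y\in\Omega}(u(z)-u(y))\frac{\omega_{zy}}{\mu(z)}$. For a vertex set $A$ and interval $I$, $C^n(A\times I)$ denotes functions $u$ with $u(x,\cdot)$ $n$ times continuously differentiable on $I$ for each $x\in A$ (one-sided at included endpoints). An upper (respectively lower) solution of (P) is a function $u\in C^1(\Omega\times[0,T])\cap C^0(\overline{\Omega}\times[0,T])$ satisfying $u_t-\Delta_\Omega u\ge(\le)\,f(x,t,u)$ on $\Omega\times(0,T]$, $\mathcal{B}u\ge(\le)\,g$ on $\partial\Omega\times(0,T]$, and $u(x,0)\ge(\le)\,\psi(x)$ on $\Omega$. *)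

(* Defs.v *)
From HB Require Import structures.
From mathcomp Require Import all_boot all_order all_algebra.
From mathcomp Require Import all_classical all_reals all_analysis.

Set Implicit Arguments.
Unset Strict Implicit.
Unset Printing Implicit Defensive.

Import Order.TTheory GRing.Theory Num.Theory.
Import numFieldNormedType.Exports.

Local Open Scope classical_set_scope.
Local Open Scope ring_scope.

(* Loops are not excluded in the host graph; they contribute nothing to the
   operators below. *)
Record weighted_graph (R : realType) (V : finType) := WeightedGraph {
  edge : rel V;
  edge_sym : symmetric edge;
  edge_connected : forall x y : V, connect edge x y;
  weight : V -> V -> R;
  weight_ge0 : forall x y, 0 <= weight x y;
  weight_sym : forall x y, weight x y = weight y x;
  weight_eq0 : forall x y, weight x y = 0 <-> ~~ edge x y;
  vmeasure : V -> R;
  vmeasure_gt0 : forall x, 0 < vmeasure x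
}.

Definition induced (V : finType) (e : rel V) (A : {set V}) : rel V :=
  [rel x y | [&& x \in A, y \in A & e x y]].

Definition connected_simple_subgraph (R : realType) (V : finType)
    (G : weighted_graph R V) (Omega : {set V}) : Prop :=
  (forall x y, x \in Omega -> y \in Omega ->
     connect (induced (edge G) Omega) x y) /\
  (forall x, x \in Omega -> ~~ edge G x x).

Definition boundary (R : realType) (V : finType)
    (G : weighted_graph R V) (Omega : {set V}) : {set V} :=
  [set z | (z \notin Omega) && [exists y in Omega, edge G z y]].

Definition gclosure (R : realType) (V : finType)
    (G : weighted_graph R V) (Omega : {set V}) : {set V} :=
  Omega :|: boundary G Omega.

Definition laplacian (R : realType) (V : finType)
    (G : weighted_graph R V) (Omega : {set V}) (v : V -> R) (x : V) : R :=
  \sum_(y in gclosure G Omega) (v y - v x) * (weight G y x / vmeasure G x).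

Definition normal_derivative (R : realType) (V : finType)
    (G : weighted_graph R V) (Omega : {set V}) (v : V -> R) (z : V) : R :=
  \sum_(y in Omega) (v z - v y) * (weight G z y / vmeasure G z).

Inductive boundary_condition := Dirichlet | Neumann.

Definition boundary_operator (R : realType) (V : finType)
    (G : weighted_graph R V) (Omega : {set V}) (bc : boundary_condition)
    (v : V -> R) (z : V) : R :=
  match bc with
  | Dirichlet => v z
  | Neumann => normal_derivative G Omega v z
  end.

(* Derivative relative to I: two-sided at interior points of an interval and
   one-sided at its included endpoints. *)
Definition diff_quotient (R : realType) (h : R -> R) (t s : R) : R :=
  (h s - h t) / (s - t).

Definition derivable_within (R : realType) (I : set R) (h : R -> R) (t : R) :
    Prop :=
  cvg (diff_quotient h t @ within I t^').

Definition derive_within (R : realType) (I : set R) (h : R -> R) (t : R) : R :=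
  lim (diff_quotient h t @ within I t^').

Fixpoint C_on (R : realType) (n : nat) (I : set R) (h : R -> R) : Prop :=
  match n with
  | 0%N => {within I, continuous h}
  | n'.+1 => (forall t, I t -> derivable_within I h t) /\
             C_on n' I (derive_within I h)
  end.

Definition C_graph (R : realType) (V : finType) (n : nat) (A : {set V})
    (I : set R) (u : V -> R -> R) : Prop :=
  forall x, x \in A -> C_on n I (u x).

(* Functions on A x [0,T] are total functions V -> R -> R; only their values
   on A x [0,T] matter. *)
Definition regular (R : realType) (V : finType) (G : weighted_graph R V)
    (Omega : {set V}) (T : R) (u : V -> R -> R) : Prop :=
  C_graph 1 Omega `[0, T] u /\ C_graph 0 (gclosure G Omega) `[0, T] u.

(* The problem (P) with its relation symbol left as the parameter cmp: the
   relation is =, >= or <= for a solution, an upper or a lower solution. *)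
Definition solves (R : realType) (cmp : R -> R -> Prop) (V : finType)
    (G : weighted_graph R V) (Omega : {set V}) (T : R)
    (f : V -> R -> R -> R) (bc : boundary_condition) (g : V -> R -> R)
    (psi : V -> R) (u : V -> R -> R) : Prop :=
  [/\ regular G Omega T u,
      forall x t, x \in Omega -> 0 < t <= T ->
        cmp (derive_within `[0, T] (u x) t - laplacian G Omega (u^~ t) x)
            (f x t (u x t)),
      forall z t, z \in boundary G Omega -> 0 < t <= T ->
        cmp (boundary_operator G Omega bc (u^~ t) z) (g z t)
    & forall x, x \in Omega -> cmp (u x 0) (psi x)].

Definition solution (R : realType) := @solves R (fun a b => a = b).
Definition upper_solution (R : realType) := @solves R (fun a b => a >= b).
Definition lower_solution (R : realType) := @solves R (fun a b => a <= b).

Definition is_min (R : realType) (A : set R) (m : R) : Prop := A m /\ lbound A m.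
Definition is_max (R : realType) (A : set R) (m : R) : Prop := A m /\ ubound A m.

Definition values (R : realType) (V : finType) (A : {set V}) (I : set R)
    (u : V -> R -> R) : set R :=
  [set r | exists x t, [/\ x \in A, I t & r = u x t]].

Definition between (R : realType) (V : finType) (A : {set V}) (I : set R)
    (lo u hi : V -> R -> R) : Prop :=
  forall x t, x \in A -> I t -> lo x t <= u x t <= hi x t.

(* Main.v *)
Require Import Defs.
From HB Require Import structures.
From mathcomp Require Import all_boot all_order all_algebra.
From mathcomp Require Import all_classical all_reals all_analysis.
From mathcomp Require Import ring lra.

Set Implicit Arguments.
Unset Strict Implicit.
Unset Printing Implicit Defensive.

Import Order.TTheory GRing.Theory Num.Theory.
Import numFieldNormedType.Exports.

Local Open Scope classical_set_scope.
Local Open Scope ring_scope.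

(** The boundary condition is solved for the boundary values: under the
Dirichlet condition they are the data, and under the Neumann condition the
value at [z] is the average of the values at the interior neighbours of [z],
weighted by the edge weights, plus a multiple of [g z t].  Substituting this
into the Laplacian turns the problem into an ordinary differential equation
with one unknown function per vertex of [Omega].  Once [f] is composed with
the projection of its last argument onto [[eta_lo, eta_hi]], the right-hand
side is globally Lipschitz, because an average is nonexpansive, and continuous
along continuous functions, so Picard iteration gives a solution on the whole
of [[0, T]] ([picard_lindelof], [global_lipschitz_solution]).

Ordering and uniqueness come from a single minimum principle
([parabolic_minimum_principle]).  If [w] is a difference of an upper and a
lower solution, the Lipschitz bound gives [w_t >= Delta w + M w] wherever
[w < 0].  At a negative minimum of [exp (- (M + 1) t) w], taken over the closure
and all times, one has [w_t <= (M + 1) w] and [Delta w >= 0], which forces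
[M w <= (M + 1) w] and contradicts [w < 0].  A minimum at a boundary vertex is
excluded by the Dirichlet condition, and under the Neumann condition it is also
attained at an interior neighbour.

The upper and lower solutions of the original problem take their values in
[[eta_lo, eta_hi]], so they remain upper and lower solutions after the
truncation of [f].  Comparison places the solution of the truncated problem
between them; there the truncation changes nothing, so this is a solution of
the original problem.  Any two solutions lying between [ulow] and [uup] solve
the truncated problem too, and comparing each with the other gives equality. *)

(** * One-sided derivatives and continuity on the time interval *)

Lemma time_interval_limit_point (R : realType) (T t : R) :
  0 < T -> 0 <= t <= T -> ProperFilter (within `[0, T] t^').
Proof.
move=> T0 /andP[t0 tT]; apply: Build_ProperFilter_ex => P.
rewrite /within /= => /nbhs_ballP[e /= e0 He].
have [tlt|tge] := ltP t T.
- exists (t + Num.min (e / 2) (T - t)).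
  have m0 : 0 < Num.min (e / 2) (T - t) by rewrite lt_min subr_gt0 tlt divr_gt0.
  have me : Num.min (e / 2) (T - t) < e.
    by rewrite gt_min; apply/orP; left; lra.
  have mT : Num.min (e / 2) (T - t) <= T - t by rewrite ge_min lexx orbT.
  apply: (He (t + _)) => //=.
  + by rewrite /ball /= opprD addNKr normrN gtr0_norm.
  + by rewrite gt_eqF // ltrDl.
  + by rewrite in_itv /=; apply/andP; split; lra.
- exists (t - Num.min (e / 2) t).
  have t1 : 0 < t by lra.
  have m0 : 0 < Num.min (e / 2) t by rewrite lt_min t1 divr_gt0.
  have me : Num.min (e / 2) t < e by rewrite gt_min; apply/orP; left; lra.
  have mT : Num.min (e / 2) t <= t by rewrite ge_min lexx orbT.
  apply: (He (t - _)) => //=.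
  + by rewrite /ball /= opprB addrC subrK gtr0_norm.
  + by rewrite lt_eqF // ltrBlDr ltrDl.
  + by rewrite in_itv /=; apply/andP; split; lra.
Qed.

Lemma derive_withinE (R : realType) (T t l : R) (h : R -> R) :
  0 < T -> 0 <= t <= T -> diff_quotient h t @ within `[0, T] t^' --> l ->
  derive_within `[0, T] h t = l.
Proof.
move=> T0 tT hl; have PF := time_interval_limit_point T0 tT.
exact/cvg_lim.
Qed.

(** Only the values on [I] enter the quotient, so [h] may be any differentiable
extension of [k] beyond [I]. *)
Lemma is_derive_within (R : realType) (I : set R) (t l : R) (k h : R -> R) :
  I t -> (forall s, I s -> k s = h s) ->
  is_derive t 1 h l -> diff_quotient k t @ within I t^' --> l.
Proof.
move=> It kh hl.
apply: (@cvg_trans _ (diff_quotient h t @ within I t^')).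
  apply: near_eq_cvg; apply: (filterS _ (withinT I _)) => s Is.
  by rewrite /diff_quotient !kh.
apply: cvg_trans; first by apply: cvg_app; exact: cvg_within.
have := @ex_derive _ _ _ _ _ _ _ hl; rewrite /derivable => dh.
have : (fun k : R => k^-1 *: (h (k *: 1 + t) - h t)) @ 0^' --> l.
  by rewrite -(@derive_val _ _ _ _ _ _ _ hl).
move=> dl.
rewrite (_ : diff_quotient h t =
  (fun k : R => k^-1 *: (h (k *: 1 + t) - h t)) \o (fun s => s - t));
  last first.
  apply/funext => s /=; rewrite /diff_quotient /GRing.scale /= mulr1 subrK.
  by rewrite mulrC.
apply: cvg_comp dl.
move=> P /= /nbhs_ballP[e /= e0 He]; apply/nbhs_ballP; exists e => //= s sB st.
apply: He => /=; last by rewrite subr_eq0.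
by move: sB; rewrite /ball /= sub0r opprB.
Qed.

Lemma diff_quotientB (R : realType) (T t : R) (h k : R -> R) (l m : R) :
  diff_quotient h t @ within `[0, T] t^' --> l ->
  diff_quotient k t @ within `[0, T] t^' --> m ->
  diff_quotient (fun s => h s - k s) t @ within `[0, T] t^' --> l - m.
Proof.
move=> hl km; rewrite (_ : diff_quotient _ _ =
  diff_quotient h t \- diff_quotient k t); first exact: cvgB.
by apply/funext => s /=; rewrite /diff_quotient -mulrBl; congr (_ / _); ring.
Qed.

Lemma derive_within_left_min (R : realType) (T t l : R) (h : R -> R) :
  0 < t <= T -> (forall s, 0 <= s < t -> h t <= h s) ->
  diff_quotient h t @ within `[0, T] t^' --> l -> l <= 0.
Proof.
move=> /andP[t0 tT] hmin hl.
have : diff_quotient h t @ t^'- --> l.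
  apply: cvg_trans hl => P; rewrite /within /= => /nbhs_ballP[e /= e0 He].
  have [d [d0 de dt]] : exists d, [/\ 0 < d, d <= e & d <= t].
    exists (Num.min e t); rewrite lt_min e0 t0; split=> //.
      by rewrite ge_min lexx.
    by rewrite ge_min lexx orbT.
  apply/nbhs_ballP; exists d => //= s sB st; apply: He => //=.
  + by apply: lt_le_trans de.
  + by rewrite lt_eqF.
  + rewrite in_itv /=; move: sB; rewrite /ball /= => /ltr_normlP[]; lra.
move=> {}hl; apply: (cvgr_to_le hl).
near=> s.
have st : s < t by [].
have s0 : 0 < s by [].
rewrite /diff_quotient mulr_ge0_le0 //; first by rewrite subr_ge0 hmin // ltW.
by rewrite invr_le0; lra.
Unshelve. all: by end_near. Qed.

(** The boundary inequalities and the Lipschitz bound are assumed for positive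
times only; continuity carries them to the initial time. *)
Lemma nonneg_up_to_initial_time (R : realType) (T : R) (h : R -> R) :
  0 < T -> {within `[0, T], continuous h} ->
  (forall t, 0 < t <= T -> 0 <= h t) -> forall t, 0 <= t <= T -> 0 <= h t.
Proof.
move=> T0 hc h0 t /andP[]; rewrite le_eqVlt => /predU1P[<- _|t0 tT]; last first.
  by apply: h0; rewrite t0.
have /continuous_within_itvP - /(_ T0)[_ hc0 _] := hc.
apply: (cvgr_to_ge hc0); near=> s; apply: h0.
by apply/andP; split; near: s; [exact: nbhs_right_gt|exact: nbhs_right_le].
Unshelve. all: by end_near. Qed.

Lemma continuous_into (U X W : topologicalType) (A : set X)
    (h : X -> W) (k : U -> X) :
  {within A, continuous h} -> continuous k -> (forall s, A (k s)) ->
  continuous (h \o k).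
Proof.
move=> /subspace_continuousP hc kc kA s; apply: (cvg_comp _ _ _ (hc _ (kA s))).
move=> P AP.
apply: (@filterS U (nbhs s) _ (fun z => A (k z) -> P (k z))).
  by move=> z; apply; exact: kA.
exact: (kc s _ AP).
Qed.

(** * Antiderivatives and geometric convergence *)

(** The integral starts at [-1], so that [[0, T]] is interior to the interval
of integration and the derivative is two-sided also at [0] and [T]. *)
Lemma antiderivative_exists (R : realType) (T : R) (h : R -> R) :
  0 < T -> continuous h ->
  exists2 H : R -> R, H 0 = 0 & forall t, 0 <= t <= T -> is_derive t 1 H (h t).
Proof.
move=> T0 hc.
pose P (t : R) := \int[lebesgue_measure]_(s in `[-1, t]) h s.
have dP t : 0 <= t <= T -> is_derive t 1 P (h t).
  move=> /andP[t0 tT].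
  have [||||dt Dt] := @continuous_FTC1_closed R h (- 1) t (T + 1).
  - lra.
  - apply: continuous_compact_integrable; first exact: segment_compact.
    exact: continuous_subspaceT.
  - lra.
  - exact: hc.
  - apply: DeriveDef; first exact: dt.
    by rewrite -derive1E; exact: Dt.
exists (fun t => P t - P 0); first by rewrite subrr.
move=> t tT; have := dP t tT => dPt.
by have := is_deriveB dPt (is_derive_cst (P 0) t 1); rewrite subr0.
Qed.

(** Both [E + H] and [E - H] are nondecreasing.  This replaces every integral
estimate in the Picard iteration. *)
Lemma mean_value_comparison (R : realType) (T : R) (H E : R -> R)
    (h e : R -> R) :
  H 0 = 0 ->
  (forall t, 0 <= t <= T -> is_derive t 1 H (h t)) ->
  (forall t, 0 <= t <= T -> is_derive t 1 E (e t)) ->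
  (forall t, 0 <= t <= T -> `|h t| <= e t) ->
  forall t, 0 <= t <= T -> `|H t| <= E t - E 0.
Proof.
move=> H0 dH dE he.
have mono (D d : R -> R) : (forall t, 0 <= t <= T -> is_derive t 1 D (d t)) ->
    (forall t, 0 <= t <= T -> 0 <= d t) ->
    forall t, 0 <= t <= T -> D 0 <= D t.
  move=> dD d0 t /andP[t0 tT].
  have oo s : s \in `]0, T[%R -> 0 <= s <= T.
    by rewrite in_itv /= => /andP[/ltW -> /ltW ->].
  apply: (@ger0_derive1_ndecr R D 0 T) => //.
  - by move=> s /oo /dD [].
  - by move=> s /oo sT; have [_ ds] := dD s sT; rewrite derive1E ds d0.
  - apply: derivable_within_continuous => s; rewrite in_itv /= => sT.
    by have [] := dD s sT.
move=> t tT; apply/ler_normlP; split.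
- suff : (E + H) 0 <= (E + H) t by rewrite !fctE H0; lra.
  apply: (mono _ (fun s => e s + h s)) => // s sT.
    by apply: is_deriveD; [exact: dE|exact: dH].
  by have /ler_normlP[] := he s sT; lra.
- suff : (E - H) 0 <= (E - H) t by rewrite !fctE H0; lra.
  apply: (mono _ (fun s => e s - h s)) => // s sT.
    by apply: is_deriveB; [exact: dE|exact: dH].
  by have /ler_normlP[] := he s sT; lra.
Qed.

(** The sequence [a n - 2 A / 2^n] is nondecreasing and [a n + 2 A / 2^n] is
nonincreasing, so the supremum of the former lies between the two. *)
Lemma geometric_cauchy (R : realType) (A : R) (a : nat -> R) :
  (forall n, `|a n.+1 - a n| <= A / 2 ^+ n) ->
  exists l, forall n, `|l - a n| <= 2 * A / 2 ^+ n.
Proof.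
move=> ha.
pose b n := a n - 2 * A / 2 ^+ n; pose c n := a n + 2 * A / 2 ^+ n.
have half n : A / 2 ^+ n = 2 * (A / 2 ^+ n.+1).
  by rewrite exprS invfM mulrCA mulVKf.
have b_nd n m : (n <= m)%N -> b n <= b m.
  apply: (@homo_leq _ b <=%R) => //; first exact: le_trans.
  move=> {}n; have /ler_normlP[] := ha n.
  rewrite /b -!mulrA half; lra.
have c_ni n m : (n <= m)%N -> c m <= c n.
  apply: (@homo_leq _ c (fun x y => y <= x)) => //.
    by move=> y x z xy yz; exact: le_trans yz xy.
  move=> {}n; have /ler_normlP[] := ha n.
  rewrite /c -!mulrA half; lra.
have A0 n : 0 <= A / 2 ^+ n by exact: le_trans (ha n).
have bc n m : b n <= c m.
  apply: (le_trans (b_nd _ _ (leq_maxl n m))).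
  apply: le_trans (c_ni _ _ (leq_maxr n m)).
  by rewrite /b /c -!mulrA; have := A0 (maxn n m); lra.
exists (sup (range b)) => n; apply/ler_normlP.
have bn : b n <= sup (range b).
  apply: ub_le_sup; last by exists n.
  by exists (c 0%N) => _ [m _ <-].
have cn : sup (range b) <= c n.
  by apply: ge_sup; [exists (b 0%N); exists 0%N|move=> _ [m _ <-]].
by move: bn cn; rewrite /b /c; split; lra.
Qed.

Lemma geometric_cvg0 (R : realType) (A : R) :
  (fun n : nat => A / 2 ^+ n) @ \oo --> (0 : R).
Proof.
rewrite -[X in _ --> X](mulr0 A); apply: cvgM; first exact: cvg_cst.
rewrite (_ : (fun n : nat => _) = (fun n => (2^-1 : R) ^+ n)); last first.
  by apply/funext => n; rewrite exprVn.
by apply: cvg_expr; rewrite ger0_norm ?invr_ge0 // invf_lt1 // ltr1n.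
Qed.

Lemma continuous_uniform_limit (R : realType) (U : topologicalType) (A : R)
    (u : U -> R) (v : nat -> U -> R) :
  (forall n, continuous (v n)) ->
  (forall n t, `|u t - v n t| <= A / 2 ^+ n) -> continuous u.
Proof.
move=> vc uv s; apply/cvgrPdist_lt => e e0.
have := @geometric_cvg0 R A.
move=> /cvgrPdist_lt/(_ (e / 3)); rewrite divr_gt0 // => /(_ isT)[N _ /(_ N)].
rewrite /= leqnn => /(_ isT); rewrite sub0r normrN => /ltr_normlP[_ AN].
have /cvgrPdist_lt/(_ (e / 3)) := vc N s; rewrite divr_gt0 // => /(_ isT).
apply: filterS => t /ltr_normlP[v1 v2].
have /ler_normlP[s1 s2] := uv N s; have /ler_normlP[t1 t2] := uv N t.
by apply/ltr_normlP; split; lra.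
Qed.

(** * Truncation to an interval *)

Definition clamp (R : realType) (a b z : R) : R := Num.max a (Num.min b z).

Lemma clamp_bounds (R : realType) (a b z : R) :
  a <= b -> a <= clamp a b z <= b.
Proof. by move=> ab; rewrite /clamp le_max lexx ge_max ab ge_min lexx. Qed.

Lemma clamp_id (R : realType) (a b z : R) : a <= z <= b -> clamp a b z = z.
Proof. by move=> /andP[az zb]; rewrite /clamp (min_idPr zb) (max_idPr az). Qed.

Lemma clamp_contraction (R : realType) (a b z w : R) :
  `|clamp a b z - clamp a b w| <= `|z - w|.
Proof.
wlog zw : z w / z <= w.
  move=> H; have [/H//|/ltW/H] := leP z w.
  by rewrite distrC (distrC w).
rewrite distrC (distrC z) (ger0_norm (_ : 0 <= w - z)) ?subr_ge0 // /clamp.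
apply/ler_normlP; case: (leP b z) => bz; case: (leP b w) => bw;
  case: (leP a b) => ab; case: (leP a z) => az; case: (leP a w) => aw;
  split; lra.
Qed.

Lemma clamp_continuous (R : realType) (a b : R) : continuous (clamp a b).
Proof.
apply: max_fun_continuous; first by move=> z; exact: cvg_cst.
by apply: min_fun_continuous => z; [exact: cvg_cst|exact: cvg_id].
Qed.

(** * Global solutions of ordinary differential equations *)

(** Picard iteration, with time clamped to [[0, T]] so that all the functions
involved are continuous on the whole line.  In the norm weighted by
[exp (- 2 L t)] the iteration halves distances, so it converges on all of
[[0, T]] at once, without a restriction to short times. *)
Lemma picard_lindelof (R : realType) (I : finType) (T L : R)
    (F : I -> R -> (I -> R) -> R) (psi : I -> R) :
  0 < T -> 0 < L ->
  (forall x (t : R) a b (d : R), 0 <= t <= T -> (forall y, `|a y - b y| <= d) ->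
     `|F x t a - F x t b| <= L * d) ->
  (forall a : I -> R -> R, (forall x, continuous (a x)) ->
     forall x, continuous (fun t => F x t (a^~ t))) ->
  exists u : I -> R -> R,
    [/\ forall x, continuous (u x),
        forall x, u x 0 = psi x
      & forall x (t : R), 0 <= t <= T ->
          diff_quotient (u x) t @ within `[0, T] t^' --> F x t (u^~ t)].
Proof.
move=> T0 L0 FL Fc.
pose tau := clamp 0 T.
have tauT t : 0 <= tau t <= T by apply: clamp_bounds; exact: ltW.
pose antider (h H : R -> R) := continuous h ->
  H 0 = 0 /\ forall t, 0 <= t <= T -> is_derive t 1 H (h t).
have /choice[J JP] : forall h, exists H, antider h H.
  move=> h.
  have [hc|hnc] := pselect (continuous h); last by exists (fun=> 0).
  by have [H H0 dH] := antiderivative_exists T0 hc; exists H.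
pose step (u : I -> R -> R) x t := psi x + J (fun s => F x s (u^~ s)) (tau t).
pose u_ n := iter n step (fun x _ => psi x).
have stepc u : (forall x, continuous (u x)) -> forall x, continuous (step u x).
  move=> uc x; have [_ dJ] := JP _ (Fc _ uc x).
  move=> t; apply: cvgD; first exact: cvg_cst.
  apply: (continuous_comp (f := tau)); first exact: clamp_continuous.
  apply: differentiable_continuous; apply/derivable1_diffP.
  by have [] := dJ _ (tauT t).
have uc n x : continuous (u_ n x).
  elim: n x => [x t|n IHn]; [exact: cvg_cst|exact: stepc].
pose k := 2 * L.
have k0 : 0 < k by rewrite mulr_gt0.
have expD (c t : R) : is_derive t 1 (fun s => c / k * expR (k * s))
    (c * expR (k * t)).
  have dk : is_derive t 1 (fun s : R => k * s) k.
    by apply: is_derive_eq; rewrite /GRing.scale /= mulr1.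
  have de : is_derive t 1 (fun s => expR (k * s)) (expR (k * t) * k).
    exact: (is_derive1_comp (is_derive_expR _) dk).
  apply: is_derive_eq.
  by rewrite /GRing.scale /= mulrCA divfK ?gt_eqF // mulrC.
(* The contraction estimate: integrating [L c exp (k s)] gives at most
   [L c / k exp (k t)], and [k = 2 L] makes the factor one half. *)
have growth u v c : 0 <= c -> (forall x, continuous (u x)) ->
    (forall x, continuous (v x)) ->
    (forall x t, 0 <= t <= T -> `|u x t - v x t| <= c * expR (k * t)) ->
    forall x t, 0 <= t <= T ->
      `|step u x t - step v x t| <= c / 2 * expR (k * t).
  move=> c0 cu cv uv x t tT.
  have [Ju0 dJu] := JP _ (Fc _ cu x); have [Jv0 dJv] := JP _ (Fc _ cv x).
  rewrite /step /tau !clamp_id // opprD addrACA subrr add0r.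
  apply: (@le_trans _ _ (L * c / k * expR (k * t) - L * c / k * expR (k * 0))).
    apply: (@mean_value_comparison R T
      (J (fun s => F x s (u^~ s)) - J (fun s => F x s (v^~ s)))
      (fun s => L * c / k * expR (k * s))
      (fun s => F x s (u^~ s) - F x s (v^~ s))
      (fun s => L * c * expR (k * s))) => //.
    - by rewrite !fctE Ju0 Jv0 subrr.
    - by move=> s sT; apply: is_deriveB; [exact: dJu|exact: dJv].
    - by move=> s sT; rewrite -mulrA; apply: FL => // y; exact: uv.
  have -> : L * c / k = c / 2.
    by rewrite /k; field; rewrite gt_eqF.
  by rewrite lerBlDr lerDl mulr_ge0 ?expR_ge0 // divr_ge0.
have FT a : exists2 B, 0 <= B & forall x t, 0 <= t <= T ->
    `|F x t (fun y => a y)| <= B.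
  have : forall x, exists B, forall t, 0 <= t <= T -> `|F x t a| <= B.
    move=> x; have fc := Fc (fun y _ => a y) (fun y t => cvg_cst _) x.
    have := @EVT_max R (fun t => `|F x t a|) 0 T (ltW T0).
    case=> [|c _ cmax]; last first.
      by exists `|F x c a| => t tT; apply: cmax; rewrite in_itv.
    apply: continuous_subspaceT => t; apply: continuous_comp; first exact: fc.
    exact: norm_continuous.
  move=> /choice[B Bb]; exists (\sum_x `|B x|); first exact: sumr_ge0.
  move=> x t tT; apply: (le_trans (Bb x t tT)); apply: (le_trans (ler_norm _)).
  by rewrite (bigD1 x) //= lerDl sumr_ge0.
have [B B0 FB] := FT psi.
have first_step x t : 0 <= t <= T ->
    `|u_ 1%N x t - u_ 0%N x t| <= B / k * expR (k * t).
  move=> tT; rewrite /= /step /tau clamp_id // addrAC subrr add0r.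
  have [J0 dJ] := JP _ (Fc (fun y _ => psi y) (fun y t => cvg_cst _) x).
  apply: (@le_trans _ _ (B / k * expR (k * t) - B / k * expR (k * 0))).
    apply: (@mean_value_comparison R T
      (J (fun s => F x s psi))
      (fun s => B / k * expR (k * s))
      (fun s => F x s psi) (fun s => B * expR (k * s))) => //.
    move=> s sT; apply: (le_trans (FB x s sT)); rewrite ler_peMr //.
    apply: le_trans (expR_ge1Dx _); rewrite lerDl mulr_ge0 ?(ltW k0) //.
    by case/andP: sT.
  by rewrite lerBlDr lerDl mulr_ge0 ?expR_ge0 // divr_ge0 // ltW.
have incr n x t : 0 <= t <= T ->
    `|u_ n.+1 x t - u_ n x t| <= B / k / 2 ^+ n * expR (k * t).
  elim: n x t => [|n IHn] x t tT; first by rewrite expr0 divr1 first_step.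
  have -> (c : R) : c / 2 ^+ n.+1 = c / 2 ^+ n / 2.
    by rewrite exprSr invfM mulrA mulrAC.
  apply: (growth (u_ n.+1) (u_ n)) => //.
  by rewrite divr_ge0 ?exprn_ge0 // divr_ge0 // ltW.
pose A := B / k * expR (k * T).
(* All the iterates depend on [t] through [tau t] only, so estimates on
   [[0, T]] hold on the whole line. *)
have u_tau n x t : u_ n x t = u_ n x (tau t).
  case: n => [|n] //=; rewrite /step; congr (_ + J _ _).
  by rewrite [RHS]/tau clamp_id.
have incrA n x t : `|u_ n.+1 x t - u_ n x t| <= A / 2 ^+ n.
  rewrite u_tau (u_tau n); apply: (le_trans (incr n x _ (tauT t))).
  rewrite /A mulrAC ler_pM2r ?invr_gt0 ?exprn_gt0 //.
  rewrite ler_wpM2l ?divr_ge0 ?(ltW k0) // ler_expR ler_pM2l //.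
  by case/andP: (tauT t).
have /choice[u uP] : forall x, exists u : R -> R,
    forall t n, `|u t - u_ n x t| <= 2 * A / 2 ^+ n.
  move=> x; suff /choice[v vP] : forall t, exists l, forall n,
      `|l - u_ n x t| <= 2 * A / 2 ^+ n by exists v.
  by move=> t; apply: geometric_cauchy => n; exact: incrA.
have ucont x : continuous (u x).
  by apply: (@continuous_uniform_limit _ _ (2 * A) _ (fun n => u_ n x)).
(* Both [u] and its image under [step] are approximated by the iterates. *)
have u_fix x t : 0 <= t <= T -> u x t = step u x t.
  move=> tT; apply/eqP; rewrite -subr_eq0 -normr_eq0 eq_le normr_ge0 andbT.
  apply: (cvgr_to_ge (@geometric_cvg0 R (A * (1 + expR (k * t))))).
  near=> n.
  have un := uP x t n.+1.
  have us : `|step (u_ n) x t - step u x t| <=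
      2 * A / 2 ^+ n / 2 * expR (k * t).
    apply: growth => // [|y s sT].
      exact: le_trans (normr_ge0 _) (uP x t n).
    rewrite distrC; apply: (le_trans (uP y s n)).
    rewrite ler_peMr //; first exact: le_trans (normr_ge0 _) (uP y s n).
    apply: le_trans (expR_ge1Dx _); rewrite lerDl mulr_ge0 ?(ltW k0) //.
    by case/andP: sT.
  have -> : u x t - step u x t =
      (u x t - u_ n.+1 x t) + (step (u_ n) x t - step u x t).
    by rewrite addrA subrK.
  apply: (le_trans (ler_normD _ _)); apply: (le_trans (lerD un us)).
  rewrite le_eqVlt; apply/orP; left; apply/eqP; rewrite exprS; field.
  by rewrite expf_neq0.
exists u; split => [||x t tT]; first exact: ucont.
  move=> x; rewrite u_fix ?lexx ?ltW // /step /tau clamp_id ?lexx ?ltW //.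
  by have [-> _] := JP _ (Fc _ ucont x); rewrite addr0.
have [_ dJ] := JP _ (Fc _ ucont x).
apply: (@is_derive_within _ _ _ _ _
  (fun s => psi x + J (fun s => F x s (u^~ s)) s)).
- by rewrite /= in_itv.
- by move=> s; rewrite /= in_itv => sT; rewrite u_fix // /step /tau clamp_id.
- have := is_deriveD (is_derive_cst (psi x) t 1) (dJ t tT).
  by rewrite add0r.
Unshelve. all: by end_near. Qed.

Lemma sum_continuous (R : realType) (U : topologicalType) (I : finType)
    (P : pred I) (h : I -> U -> R) :
  (forall i, P i -> continuous (h i)) ->
  continuous (fun t => \sum_(i | P i) h i t).
Proof.
move=> hc t; apply: cvg_big => [|i Pi]; last exact: hc.
exact: add_continuous.
Qed.

(** * Operators on the graph and the minimum principle *)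

Section GraphOperators.
Variables (R : realType) (V : finType) (G : weighted_graph R V).
Variables (Omega : {set V}) (bc : boundary_condition).

Local Notation bd := (boundary G Omega).
Local Notation cl := (gclosure G Omega).

Lemma interior_closure x : x \in Omega -> x \in cl.
Proof. by rewrite /gclosure finset.in_setU => ->. Qed.

Lemma boundary_closure x : x \in bd -> x \in cl.
Proof. by rewrite /gclosure finset.in_setU => ->; rewrite orbT. Qed.

Lemma boundary_notin x : x \in bd -> x \notin Omega.
Proof. by rewrite inE => /andP[]. Qed.

Lemma closure_case x : x \in cl -> x \in Omega \/ x \in bd.
Proof. by rewrite /gclosure finset.in_setU => /orP. Qed.

Lemma coefficient_ge0 x y z : 0 <= weight G x y / vmeasure G z.
Proof. by rewrite divr_ge0 ?weight_ge0 // ltW // vmeasure_gt0. Qed.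

Lemma weight_gt0 x y : edge G x y -> 0 < weight G x y.
Proof.
move=> xy; rewrite lt_def weight_ge0 andbT; apply/eqP => /weight_eq0.
by rewrite xy.
Qed.

Lemma boundary_weight_gt0 z : z \in bd -> 0 < \sum_(y in Omega) weight G z y.
Proof.
rewrite inE => /andP[_ /existsP[y /andP[yO zy]]].
rewrite (bigD1 y) //= ltr_pwDl ?weight_gt0 //.
by apply: sumr_ge0 => *; exact: weight_ge0.
Qed.

Lemma laplacianB (v w : V -> R) x :
  laplacian G Omega (fun y => v y - w y) x =
  laplacian G Omega v x - laplacian G Omega w x.
Proof.
rewrite /laplacian -sumrB; apply: eq_bigr => y _; rewrite -mulrBl.
by congr (_ * _); ring.
Qed.

Lemma laplacian_lipschitz (v w : V -> R) (d : R) x : x \in cl ->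
  (forall y, y \in cl -> `|v y - w y| <= d) ->
  `|laplacian G Omega v x - laplacian G Omega w x| <=
    2 * (\sum_(y in cl) weight G y x / vmeasure G x) * d.
Proof.
move=> xc vw; rewrite /laplacian -sumrB mulrAC mulr_sumr.
apply: (le_trans (ler_norm_sum _ _ _)); apply: ler_sum => y yc.
rewrite -mulrBl normrM (ger0_norm (coefficient_ge0 _ _ _)).
apply: ler_wpM2r; first exact: coefficient_ge0.
have -> : v y - v x - (w y - w x) = (v y - w y) - (v x - w x) by ring.
apply: (le_trans (ler_normB _ _)).
by have := vw y yc; have := vw x xc; lra.
Qed.

Lemma boundary_operatorB (v w : V -> R) z :
  boundary_operator G Omega bc (fun y => v y - w y) z =
  boundary_operator G Omega bc v z - boundary_operator G Omega bc w z.
Proof.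
case: bc => //=; rewrite /normal_derivative -sumrB; apply: eq_bigr => y _.
by rewrite -mulrBl; congr (_ * _); ring.
Qed.

Lemma laplacian_continuous (U : topologicalType) (w : V -> U -> R) x :
  x \in cl -> (forall y, y \in cl -> continuous (w y)) ->
  continuous (fun t => laplacian G Omega (w^~ t) x).
Proof.
move=> xc wc; apply: sum_continuous => y yc t.
by apply: cvgM; [apply: cvgB; exact: wc|exact: cvg_cst].
Qed.

Lemma boundary_operator_continuous (U : topologicalType) (w : V -> U -> R) z :
  z \in bd -> (forall y, y \in cl -> continuous (w y)) ->
  continuous (fun t => boundary_operator G Omega bc (w^~ t) z).
Proof.
move=> zb wc; have zc := boundary_closure zb.
case: bc => /=; first exact: wc.
apply: sum_continuous => y yO t; have yc := interior_closure yO.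
by apply: cvgM; [apply: cvgB; exact: wc|exact: cvg_cst].
Qed.

(** The Dirichlet case is void.  In the Neumann case the normal derivative is a
sum of nonpositive terms, so all of them vanish, and the coefficient of a
neighbour of [z] is positive. *)
Lemma boundary_minimum (v : V -> R) z : z \in bd -> v z < 0 ->
  (forall y, y \in Omega -> v z <= v y) ->
  0 <= boundary_operator G Omega bc v z ->
  exists2 y, y \in Omega & v y = v z.
Proof.
move=> zb vz0 vmin; case: bc => /= [vz|bz].
  by move: (lt_le_trans vz0 vz); rewrite ltxx.
move: (zb); rewrite inE => /andP[_ /existsP[y /andP[yO zy]]]; exists y => //.
have term_le0 i : i \in Omega ->
    (v z - v i) * (weight G z i / vmeasure G z) <= 0.
  by move=> iO; rewrite mulr_le0_ge0 ?coefficient_ge0 // subr_le0 vmin.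
move: bz; rewrite /normal_derivative (bigD1 y) //= => bz.
have rest : \sum_(i in Omega | i != y)
    (v z - v i) * (weight G z i / vmeasure G z) <= 0.
  by apply: sumr_le0 => i /andP[iO _]; exact: term_le0.
have c0 : 0 < weight G z y / vmeasure G z.
  by rewrite divr_gt0 ?weight_gt0 ?vmeasure_gt0.
have := term_le0 y yO; rewrite pmulr_lle0 // => le0.
have : 0 <= (v z - v y) * (weight G z y / vmeasure G z) by lra.
by rewrite pmulr_lge0 //; lra.
Qed.

(** The values on the boundary that the condition [bc] with data [gt] imposes
on a function that equals [a] on [Omega]. *)
Definition boundary_extension (gt a : V -> R) (z : V) : R :=
  if z \in Omega then a z else
  match bc with
  | Dirichlet => gt z
  | Neumann => (gt z * vmeasure G z + \sum_(y in Omega) a y * weight G z y) /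
               \sum_(y in Omega) weight G z y
  end.

Lemma boundary_extension_interior gt a x :
  x \in Omega -> boundary_extension gt a x = a x.
Proof. by rewrite /boundary_extension => ->. Qed.

Lemma boundary_extension_operator gt a z : z \in bd ->
  boundary_operator G Omega bc (boundary_extension gt a) z = gt z.
Proof.
move=> zb; have zO := boundary_notin zb.
have S0 := boundary_weight_gt0 zb; have m0 := vmeasure_gt0 G z.
have : boundary_extension gt a z = match bc with
  | Dirichlet => gt z
  | Neumann => (gt z * vmeasure G z + \sum_(y in Omega) a y * weight G z y) /
               \sum_(y in Omega) weight G z y
  end by rewrite /boundary_extension (negPf zO).
rewrite /boundary_operator /normal_derivative; case: bc => // ->.
set S := \sum_(y in Omega) weight G z y.
set W := \sum_(y in Omega) a y * weight G z y.
rewrite (eq_bigr (fun y => (gt z * vmeasure G z + W) / S / vmeasure G z *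
    weight G z y - (vmeasure G z)^-1 * (a y * weight G z y))); last first.
  by move=> y yO; rewrite boundary_extension_interior //; ring.
rewrite sumrB -!mulr_sumr -/S -/W; field.
by rewrite !gt_eqF.
Qed.

(** The data [gt] cancel in the difference, which is zero in the Dirichlet case
and a weighted average of the differences [a y - b y] in the Neumann case. *)
Lemma boundary_extension_nonexpansive gt a b d z : z \in cl ->
  (forall y, `|a y - b y| <= d) ->
  `|boundary_extension gt a z - boundary_extension gt b z| <= d.
Proof.
move=> zc ab; have d0 : 0 <= d by apply: le_trans (ab z).
rewrite /boundary_extension; case: ifPn => zO //; case: bc.
  by rewrite subrr normr0.
have [|zb] := closure_case zc; first by rewrite (negPf zO).
have S0 := boundary_weight_gt0 zb.
rewrite -mulrBl opprD addrACA subrr add0r -sumrB normrM.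
have Si0 : 0 < (\sum_(y in Omega) weight G z y)^-1 by rewrite invr_gt0.
rewrite (gtr0_norm Si0) ler_pdivrMr // mulr_sumr.
apply: (le_trans (ler_norm_sum _ _ _)); apply: ler_sum => y _.
rewrite -mulrBl normrM (ger0_norm (weight_ge0 _ _ _)).
by rewrite ler_wpM2r ?weight_ge0.
Qed.

Lemma boundary_extension_continuous (U : topologicalType)
    (g a : V -> U -> R) z :
  z \in cl -> (forall y, y \in bd -> continuous (g y)) ->
  (forall y, continuous (a y)) ->
  continuous (fun t => boundary_extension (g^~ t) (a^~ t) z).
Proof.
move=> zc gc ac; rewrite /boundary_extension.
have [_|zO] := boolP (z \in Omega); first exact: ac.
have [zO'|zb] := closure_case zc; first by rewrite zO' in zO.
case: bc => [|t]; first exact: gc.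
apply: cvgM; last exact: cvg_cst.
apply: cvgD; first by apply: cvgM; [exact: gc|exact: cvg_cst].
by apply: sum_continuous => y yO s; apply: cvgM; [exact: ac|exact: cvg_cst].
Qed.

(** At a negative minimum of [exp (- K t) w] with [K > M], the time derivative
of [w] is at most [K w] and the Laplacian is nonnegative; since [K w < M w]
there, this contradicts the differential inequality. *)
Lemma parabolic_minimum_principle (T M : R) (w wt : V -> R -> R) :
  0 < T ->
  (forall x, x \in cl -> {within `[0, T], continuous (w x)}) ->
  (forall x t, x \in Omega -> 0 < t <= T ->
     diff_quotient (w x) t @ within `[0, T] t^' --> wt x t) ->
  (forall x t, x \in Omega -> 0 < t <= T -> w x t < 0 ->
     laplacian G Omega (w^~ t) x + M * w x t <= wt x t) ->
  (forall z t, z \in bd -> 0 < t <= T ->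
     0 <= boundary_operator G Omega bc (w^~ t) z) ->
  (forall x, x \in Omega -> 0 <= w x 0) ->
  forall x t, x \in cl -> 0 <= t <= T -> 0 <= w x t.
Proof.
move=> T0 wc dw wM wb w0 x1 t1 x1c t1T; rewrite leNgt; apply/negP => w1.
have wb' z t : z \in bd -> 0 <= t <= T ->
    0 <= boundary_operator G Omega bc (w^~ t) z.
  move=> zb; apply: (@nonneg_up_to_initial_time R T
    (fun s => boundary_operator G Omega bc (w^~ s) z)) => //.
    exact: (@boundary_operator_continuous (subspace `[0, T])).
  by move=> s; exact: wb.
(* Any rate above [M] makes the final inequality strict. *)
pose K := M + 1.
pose v x t := expR (- (K * t)) * w x t.
have vc x : x \in cl -> {within `[0, T], continuous (v x)}.
  move=> xc; have ec : continuous (fun t : R => expR (- (K * t))).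
    move=> t; apply: continuous_comp; last exact: continuous_expR.
    by apply: cvgN; apply: cvgM; [exact: cvg_cst|exact: cvg_id].
  move=> t; apply: cvgM; last exact: wc.
  exact: (@continuous_subspaceT _ _ `[0, T] _ ec).
have /choice[m mP] : forall x, exists m, x \in cl ->
    0 <= m <= T /\ forall t, 0 <= t <= T -> v x m <= v x t.
  move=> x; have [xc|xc] := boolP (x \in cl); last by exists 0.
  have [m mT mmin] := EVT_min (ltW T0) (vc x xc).
  by exists m => _; split=> [|t tT]; [|apply: mmin]; rewrite ?in_itv in mT *.
have [x2 x2c x2min] := @arg_minP _ R V x1 (mem cl) (fun x => v x (m x)) x1c.
have [t0T _] := mP x2 x2c.
have vmin x t : x \in cl -> 0 <= t <= T -> v x2 (m x2) <= v x t.
  by move=> xc tT; apply: le_trans (x2min x xc) _; have [_] := mP x xc; apply.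
move: (m x2) t0T vmin => t0 t0T vmin {x2min}.
have v_lt0 x t : (v x t < 0) = (w x t < 0) by rewrite /v pmulr_rlt0 ?expR_gt0.
have w2 : w x2 t0 < 0 by rewrite -v_lt0 (le_lt_trans (vmin _ _ x1c t1T)) ?v_lt0.
have wmin y : y \in cl -> w x2 t0 <= w y t0.
  by move=> yc; have := vmin y t0 yc t0T; rewrite /v ler_pM2l ?expR_gt0.
(* A minimum at a boundary vertex is moved into [Omega]. *)
have [x0 x0O x0E] : exists2 x, x \in Omega & w x t0 = w x2 t0.
  have [x2O|x2b] := closure_case x2c; first by exists x2.
  apply: (boundary_minimum x2b w2) => [y /interior_closure|]; first exact: wmin.
  exact: wb'.
have {}vmin t : 0 <= t <= T -> v x0 t0 <= v x0 t.
  by move=> tT; rewrite {1}/v x0E vmin ?interior_closure.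
rewrite -x0E in w2 wmin.
have t0_gt0 : 0 < t0.
  case/andP: t0T; rewrite le_eqVlt => /predU1P[t00|//].
  by move: w2; rewrite -t00 ltNge w0.
have t0T' : 0 < t0 <= T by rewrite t0_gt0; case/andP: t0T.
have lap0 : 0 <= laplacian G Omega (w^~ t0) x0.
  apply: sumr_ge0 => y yc; apply: mulr_ge0; last exact: coefficient_ge0.
  by rewrite subr_ge0 wmin.
(* The function [w x0 s - w x0 t0 * exp (K (s - t0))] has the sign of
   [v x0 s - v x0 t0] and vanishes at [t0]. *)
have : wt x0 t0 - K * w x0 t0 <= 0.
  apply: (@derive_within_left_min R T t0 _
    (fun s => w x0 s - w x0 t0 * expR (K * (s - t0)))) => //.
    move=> s /andP[s0 st]; have sT : 0 <= s <= T by rewrite s0; lra.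
    rewrite subrr mulr0 expR0 mulr1 subrr subr_ge0.
    have -> : w x0 s = expR (K * s) * v x0 s.
      by rewrite /v mulrA -expRD subrr expR0 mul1r.
    have -> : w x0 t0 * expR (K * (s - t0)) = expR (K * s) * v x0 t0.
      by rewrite /v mulrA -expRD mulrBr mulrC.
    by rewrite ler_pM2l ?expR_gt0 // vmin.
  apply: diff_quotientB; first exact: dw.
  apply: (is_derive_within _ (fun _ _ => erefl)) => /=; first by rewrite in_itv.
  have dk : is_derive t0 1 (fun s : R => K * (s - t0)) K.
    by apply: is_derive_eq; rewrite /GRing.scale /= subr0 mulr1.
  have de : is_derive t0 1 (fun s => expR (K * (s - t0)))
      (expR (K * (t0 - t0)) * K).
    exact: (is_derive1_comp (is_derive_expR _) dk).
  apply: is_derive_eq.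
  by rewrite /GRing.scale /= subrr mulr0 expR0 mul1r mulrC.
have := wM x0 t0 x0O t0T' w2; rewrite /K; lra.
Qed.

End GraphOperators.

(** * Comparison and existence for the boundary value problem *)

Section Problem.
Variables (R : realType) (V : finType) (G : weighted_graph R V).
Variables (Omega : {set V}) (T : R) (bc : boundary_condition).
Hypothesis T_gt0 : 0 < T.

Local Notation bd := (boundary G Omega).
Local Notation cl := (gclosure G Omega).

(** The minimum principle applies to [v - w]: where this is negative, the source
difference is at least [- M * `|v - w| = M * (v - w)]. *)
Lemma comparison_principle (phi : V -> R -> R -> R) (M : R) (g : V -> R -> R)
    (psi : V -> R) (v w : V -> R -> R) :
  upper_solution G Omega T phi bc g psi v ->
  lower_solution G Omega T phi bc g psi w ->
  (forall x t, x \in Omega -> 0 < t <= T ->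
     `|phi x t (v x t) - phi x t (w x t)| <= M * `|v x t - w x t|) ->
  forall x t, x \in cl -> 0 <= t <= T -> w x t <= v x t.
Proof.
move=> [[v1 v0] veq vbd vinit] [[w1 w0] weq wbd winit] lip x t xc tT.
rewrite -subr_ge0.
have dq (u : V -> R -> R) y s : C_graph 1 Omega `[0, T] u -> y \in Omega ->
    0 < s <= T -> diff_quotient (u y) s @ within `[0, T] s^' -->
    derive_within `[0, T] (u y) s.
  move=> u1 yO /andP[s0 sT]; have [du _] := u1 y yO.
  by apply: du; rewrite /= in_itv /= (ltW s0).
apply: (@parabolic_minimum_principle R V G Omega bc T M
  (fun y s => v y s - w y s)
  (fun y s => derive_within `[0, T] (v y) s - derive_within `[0, T] (w y) s))
  => // {x t xc tT}.
- by move=> x xc t; apply: cvgB; [exact: v0|exact: w0].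
- by move=> x t xO tT; apply: diff_quotientB; exact: dq.
- move=> x t xO tT wv; rewrite laplacianB.
  have := lip x t xO tT; rewrite (ltr0_norm wv) => /ler_normlP[lip1 lip2].
  have := veq x t xO tT; have := weq x t xO tT; lra.
- move=> z t zb tT; rewrite boundary_operatorB subr_ge0.
  exact: le_trans (wbd z t zb tT) (vbd z t zb tT).
- by move=> x xO; rewrite subr_ge0; exact: le_trans (winit x xO) (vinit x xO).
Qed.

Lemma solution_upper phi g psi u :
  solution G Omega T phi bc g psi u -> upper_solution G Omega T phi bc g psi u.
Proof.
by move=> [ru ueq ubd uinit]; split=> // [x t xO tT|z t zb tT|x xO];
  rewrite ?ueq ?ubd ?uinit.
Qed.

Lemma solution_lower phi g psi u :
  solution G Omega T phi bc g psi u -> lower_solution G Omega T phi bc g psi u.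
Proof.
by move=> [ru ueq ubd uinit]; split=> // [x t xO tT|z t zb tT|x xO];
  rewrite ?ueq ?ubd ?uinit.
Qed.

Lemma eq_source (cmp : R -> R -> Prop) phi phi' g psi u :
  (forall x t, x \in Omega -> 0 < t <= T ->
     phi x t (u x t) = phi' x t (u x t)) ->
  solves cmp G Omega T phi bc g psi u -> solves cmp G Omega T phi' bc g psi u.
Proof.
move=> pp [ru ueq ubd uinit]; split=> // x t xO tT.
by rewrite -pp //; exact: ueq.
Qed.

(** The boundary values are eliminated with [boundary_extension]; the resulting
ordinary differential equation lives on all vertices, with zero right-hand
side outside [Omega]. *)
Lemma global_lipschitz_solution (phi : V -> R -> R -> R) (M : R)
    (g : V -> R -> R) (psi : V -> R) :
  0 < M ->
  C_graph 0 bd `[0, T] g ->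
  (forall x a, x \in Omega -> continuous a ->
     continuous (fun t => phi x t (a t))) ->
  (forall x t v w, x \in Omega -> 0 <= t <= T ->
     `|phi x t v - phi x t w| <= M * `|v - w|) ->
  exists u, solution G Omega T phi bc g psi u.
Proof.
move=> M0 gc phic lip.
pose gT z t := g z (clamp 0 T t).
have clampT t : 0 <= clamp 0 T t <= T by apply: clamp_bounds; exact: ltW.
have gTc z : z \in bd -> continuous (gT z).
  move=> zb; apply: (@continuous_into _ _ _ _ (g z) (clamp 0 T) (gc z zb)).
    exact: clamp_continuous.
  by move=> s; rewrite /= in_itv; exact: clampT.
pose ext t a := boundary_extension G Omega bc (gT^~ t) a.
pose F x t a := if x \in Omega then
  laplacian G Omega (ext t a) x + phi x t (a x) else 0.
pose c x := 2 * \sum_(y in cl) weight G y x / vmeasure G x.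
have c0 x : 0 <= c x.
  by apply: mulr_ge0 => //; apply: sumr_ge0 => y _; exact: coefficient_ge0.
pose L := M + \sum_x c x.
have L0 : 0 < L by rewrite ltr_pwDl // sumr_ge0.
have cL x : c x + M <= L.
  by rewrite addrC lerD2l (bigD1 x) //= lerDl sumr_ge0.
have FL x (t : R) a b (d : R) : 0 <= t <= T -> (forall y, `|a y - b y| <= d) ->
    `|F x t a - F x t b| <= L * d.
  move=> tT ab; have d0 : 0 <= d by apply: le_trans (ab x).
  rewrite /F; case: ifPn => xO; last by rewrite subrr normr0 mulr_ge0 // ltW.
  have xc : x \in cl := interior_closure G xO.
  rewrite opprD addrACA; apply: (le_trans (ler_normD _ _)).
  apply: (@le_trans _ _ (c x * d + M * d)); last first.
    by rewrite -mulrDl ler_wpM2r.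
  apply: lerD.
    apply: laplacian_lipschitz => // y yc.
    exact: boundary_extension_nonexpansive.
  by apply: (le_trans (lip x t _ _ xO tT)); rewrite ler_pM2l.
have Fc (a : V -> R -> R) : (forall x, continuous (a x)) ->
    forall x, continuous (fun t => F x t (a^~ t)).
  move=> ac x; rewrite /F; have [xO|_] := boolP (x \in Omega); last first.
    by move=> t; exact: cvg_cst.
  move=> t; apply: cvgD; last exact: phic.
  apply: (@laplacian_continuous R V G Omega R (fun y t => ext t (a^~ t) y)).
    exact: interior_closure.
  by move=> y yc; exact: boundary_extension_continuous.
have [u [uc u0 du]] := picard_lindelof psi T_gt0 L0 FL Fc.
pose U x t := ext t (u^~ t) x.
have Uu x : x \in Omega -> U x = u x.
  by move=> xO; apply/funext => t; exact: boundary_extension_interior.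
have Uc x : x \in cl -> continuous (U x).
  by move=> xc; exact: boundary_extension_continuous.
have dU x t : x \in Omega -> 0 <= t <= T ->
    derive_within `[0, T] (U x) t =
    laplacian G Omega (U^~ t) x + phi x t (U x t).
  move=> xO tT; rewrite (Uu x xO).
  rewrite (derive_withinE T_gt0 tT (du x t tT)) /F xO.
  by [].
exists U; split; first split.
- move=> x xO; split=> [t tT|].
    rewrite /derivable_within (Uu x xO); apply/cvg_ex; exists (F x t (u^~ t)).
    by apply: du; move: tT; rewrite /= in_itv.
  apply: (@subspace_eq_continuous _ _ _
    (fun t => laplacian G Omega (U^~ t) x + phi x t (U x t))).
    by move=> t; rewrite inE /= in_itv /= => tT; exact/esym/dU.
  apply: continuous_subspaceT => t; apply: cvgD.
    by apply: laplacian_continuous => //; exact: interior_closure.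
  by apply: phic => //; apply: Uc; exact: interior_closure.
- by move=> x xc; apply: continuous_subspaceT; exact: Uc.
- by move=> x t xO /andP[t0 tT]; rewrite dU ?(ltW t0) // addrC addKr.
- move=> z t zb /andP[t0 tT]; rewrite boundary_extension_operator //.
  by rewrite /gT clamp_id // (ltW t0).
- by move=> x xO; rewrite Uu.
Qed.

End Problem.

Theorem theorem4p2 (R : realType) (V : finType) (G : weighted_graph R V)
    (Omega : {set V}) (T : R) (f : V -> R -> R -> R) (bc : boundary_condition)
    (g : V -> R -> R) (psi : V -> R) (uup ulow : V -> R -> R)
    (eta_lo eta_hi M : R) :
  connected_simple_subgraph G Omega ->
  boundary G Omega != finset.set0 ->
  0 < T ->
  C_graph 0 (boundary G Omega) `[0, T] g ->
  upper_solution G Omega T f bc g psi uup ->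
  lower_solution G Omega T f bc g psi ulow ->
  is_min (values (gclosure G Omega) `[0, T]
            (fun x t => Num.min (uup x t) (ulow x t))) eta_lo ->
  is_max (values (gclosure G Omega) `[0, T]
            (fun x t => Num.max (uup x t) (ulow x t))) eta_hi ->
  (forall x, x \in Omega ->
     {within `[0, T] `*` `[eta_lo, eta_hi],
        continuous (fun p : R * R => f x p.1 p.2)}) ->
  0 < M ->
  (forall x t v w, x \in Omega -> 0 < t <= T ->
     eta_lo <= v <= eta_hi -> eta_lo <= w <= eta_hi ->
     `|f x t v - f x t w| <= M * `|v - w|) ->
  exists u : V -> R -> R,
    [/\ solution G Omega T f bc g psi u,
        between (gclosure G Omega) `[0, T] ulow u uup
      & forall v : V -> R -> R,
          solution G Omega T f bc g psi v ->
          between (gclosure G Omega) `[0, T] ulow v uup ->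
          forall x t, x \in gclosure G Omega -> t \in `[0, T] ->
            v x t = u x t].
Proof.
move=> _ bd0 T0 gc up lo etalo etahi fcont M0 lip.
have range x t : x \in gclosure G Omega -> 0 <= t <= T ->
    eta_lo <= ulow x t <= eta_hi /\ eta_lo <= uup x t <= eta_hi.
  move=> xc tT; have tT' : `[0, T]%classic t by rewrite /= in_itv.
  have := etalo.2 _ (ex_intro _ x (ex_intro _ t (And3 xc tT' erefl))).
  have := etahi.2 _ (ex_intro _ x (ex_intro _ t (And3 xc tT' erefl))).
  by rewrite le_min ge_max => /andP[-> ->] /andP[-> ->].
have eta : eta_lo <= eta_hi.
  have [x [t [xc tT _]]] := etalo.1.
  have [] := range x t xc; first by move: tT; rewrite /= in_itv.
  by move=> /andP[el eh] _; exact: le_trans el eh.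
(* The truncated source; clamping the time as well makes it continuous along
   continuous functions on the whole line. *)
pose phi x t z := f x (clamp 0 T t) (clamp eta_lo eta_hi z).
have clampT t : 0 <= clamp 0 T t <= T by apply: clamp_bounds; exact: ltW.
have phic x a : x \in Omega -> continuous a ->
    continuous (fun t => phi x t (a t)).
  move=> xO ac; apply: (@continuous_into _ _ _ _ _
    (fun t => (clamp 0 T t, clamp eta_lo eta_hi (a t))) (fcont x xO)).
    move=> t; apply: (@cvg_pair _ _ _ _ (nbhs (clamp 0 T t))
      (nbhs (clamp eta_lo eta_hi (a t)))); first exact: clamp_continuous.
    apply: (@continuous_comp _ _ _ a (clamp eta_lo eta_hi)); first exact: ac.
    exact: clamp_continuous.
  by move=> t; split; rewrite /= in_itv /= ?clampT ?clamp_bounds.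
have phi_lip x t v w : x \in Omega -> 0 <= t <= T ->
    `|phi x t v - phi x t w| <= M * `|v - w|.
  move=> xO tT; rewrite -subr_ge0; move: t tT.
  apply: (@nonneg_up_to_initial_time R T
    (fun t => M * `|v - w| - `|phi x t v - phi x t w|)) => //.
    apply: continuous_subspaceT => t; apply: cvgB; first exact: cvg_cst.
    apply: cvg_norm; apply: cvgB.
      by apply: (phic x (fun=> v)) => // s; exact: cvg_cst.
    by apply: (phic x (fun=> w)) => // s; exact: cvg_cst.
  move=> t /andP[t0 tT]; rewrite subr_ge0 /phi clamp_id ?(ltW t0) //.
  apply: le_trans (lip x t _ _ xO _ _ _) _; rewrite ?t0 ?clamp_bounds //.
  by rewrite ler_pM2l // clamp_contraction.
have phiE x t z : 0 < t <= T -> eta_lo <= z <= eta_hi -> f x t z = phi x t z.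
  by move=> /andP[t0 tT] z_in; rewrite /phi !clamp_id // (ltW t0).
have upphi : upper_solution G Omega T phi bc g psi uup.
  apply: eq_source up => x t xO tT; apply: phiE => //.
  have [] := range x t (interior_closure G xO) => //.
  by case/andP: tT => /ltW -> ->.
have lophi : lower_solution G Omega T phi bc g psi ulow.
  apply: eq_source lo => x t xO tT; apply: phiE => //.
  have [] := range x t (interior_closure G xO) => //.
  by case/andP: tT => /ltW -> ->.
have cmp v w : upper_solution G Omega T phi bc g psi v ->
    lower_solution G Omega T phi bc g psi w ->
    forall x t, x \in gclosure G Omega -> 0 <= t <= T -> w x t <= v x t.
  move=> vup wlo; apply: (comparison_principle T0 vup wlo (M := M)).
  by move=> x t xO /andP[t0 tT]; apply: phi_lip => //; rewrite (ltW t0).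
have [u usol] := global_lipschitz_solution bc T0 psi M0 gc phic phi_lip.
have inrange v x t : between (gclosure G Omega) `[0, T] ulow v uup ->
    x \in Omega -> 0 < t <= T -> eta_lo <= v x t <= eta_hi.
  move=> vb xO /andP[t0 tT]; have xc := interior_closure G xO.
  have tT' : 0 <= t <= T by rewrite (ltW t0).
  have /andP[lv vu] : ulow x t <= v x t <= uup x t.
    by apply: vb; rewrite //= in_itv.
  have [/andP[el _] /andP[_ eu]] := range x t xc tT'.
  by rewrite (le_trans el lv) (le_trans vu eu).
have ub : between (gclosure G Omega) `[0, T] ulow u uup.
  move=> x t xc; rewrite /= in_itv /= => tT.
  by rewrite !cmp //; [exact: solution_lower|exact: solution_upper].
exists u; split=> // [|v vsol vb x t xc].
  by apply: eq_source usol => x t xO tT; rewrite phiE // inrange.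
rewrite in_itv /= => tT.
have vphi : solution G Omega T phi bc g psi v.
  by apply: eq_source vsol => y s yO sT; rewrite phiE // inrange.
by apply/eqP; rewrite eq_le !cmp //;
  do [exact: solution_lower|exact: solution_upper].
Qed.
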